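(* Let $k \ge 0$ be an integer and let $n = 5k+4$. Write $p_n(b) = \sum_{t=0}^{n} c_t b^t$ with $c_t \in \mathbb{Z}$. Then: (i) For each $r \in \{1,2,3,4\}$, the number of indices $t$ with $c_t \equiv r \pmod 5$ is the same (the nonzero residues mod $5$ equally populate the classes $1,2,3,4$). (ii) The residues appear in groups of four as a rotation of the list $(2,4,3,1)$: for each integer $s$ with $0 \le s \le k$, the tuple $(c_{k+4s+1}, c_{k+4s+2}, c_{k+4s+3}, c_{k+4s+4})$ reduced mod $5$ is either $(0,0,0,0)$ or one of the cyclic rotations $(2,4,3,1)$, $(4,3,1,2)$, $(3,1,2,4)$, $(1,2,4,3)$. (iii) $c_t \equiv 0 \pmod 5$ for all $0 \le t \le k$.
   Context: For a complex indeterminate $b$, define polynomials $p_n(b)$ by the formal power series identity $\prod_{j=1}^{\infty} (1-q^j)^{b-1} = \sum_{n=0}^{\infty} \frac{q^n}{n!}\, p_n(b)$. Each $p_n(b)$ is a polynomial of degree $n$ in $b$ with integer coefficients. *)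

(* Defs.v *)
From HB Require Import structures.
From mathcomp Require Import all_boot all_order all_algebra.

Set Implicit Arguments.
Unset Strict Implicit.
Unset Printing Implicit Defensive.

Import Order.TTheory GRing.Theory Num.Theory.

Local Open Scope ring_scope.

(* A formal power series in q over A is its coefficient sequence: [f n] is
   the coefficient of q^n. *)
Definition fps (A : Type) := nat -> A.

Definition fps_one (A : nzRingType) : fps A := fun n => (n == 0%N)%:R.

Definition fps_mul (A : nzRingType) (f g : fps A) : fps A :=
  fun n => \sum_(i < n.+1) f i * g (n - i)%N.

(* F 1 * F 2 * ... * F N *)
Fixpoint fps_prod (A : nzRingType) (F : nat -> fps A) (N : nat) : fps A :=
  if N is N'.+1 then fps_mul (fps_prod F N') (F N) else fps_one A.

(* The product of the F j over all j >= 1 is g, for the q-adic topology with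
   A discrete: each coefficient of the partial products is eventually equal
   to that of g. *)
Definition is_fps_infprod (A : nzRingType) (F : nat -> fps A) (g : fps A) :=
  forall n, exists N0, forall N, (N0 <= N)%N -> fps_prod F N n = g n.

(* The generalized binomial coefficient a (a - 1) ... (a - m + 1) / m! *)
Definition gbinom (C : fieldType) (a : {poly C}) (m : nat) : {poly C} :=
  m`!%:R^-1 *: \prod_(i < m) (a - i%:R).

(* (1 - q^j)^a, for 0 < j, as the binomial series
   \sum_m (gbinom a m) (- q^j)^m. *)
Definition fps_pow_1subqX (C : fieldType) (j : nat) (a : {poly C}) :
    fps {poly C} :=
  fun n => if (j %| n)%N then (-1) ^+ (n %/ j) *: gbinom a (n %/ j) else 0.

(* The identity \prod_(j >= 1) (1 - q^j)^(b - 1) = \sum_n p_n(b) q^n / n!,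
   which determines p; the indeterminate b is 'X. *)
Definition eta_power_identity (C : numClosedFieldType) (p : nat -> {poly C}) :=
  is_fps_infprod (fun j => fps_pow_1subqX j ('X - 1))
                 (fun n => n`!%:R^-1 *: p n).

(* Both hypotheses of a statement about "the coefficients c_t of p_n" can be
   met: the polynomials p_n exist, and have degree at most n and integer
   coefficients.  The class of exponential generating functions of such
   sequences is closed under products. *)
Definition int_poly_upto (C : numClosedFieldType) n (u : {poly C}) :=
  exists2 c : {poly int}, u = map_poly intr c & (size c <= n.+1)%N.

Definition int_egf (C : numClosedFieldType) (f : fps {poly C}) :=
  forall n, int_poly_upto n (n`!%:R *: f n).

Lemma natf_fact_neq0 (C : numClosedFieldType) n : n`!%:R != 0 :> C.
Proof. by rewrite pnatr_eq0 -lt0n fact_gt0. Qed.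

Lemma int_egf_one (C : numClosedFieldType) : int_egf (fps_one {poly C}).
Proof.
move=> n; exists (n == 0%N)%:R.
  by rewrite /fps_one rmorph_nat; case: n => [|n]; rewrite ?scale1r ?scaler0.
by case: (n == 0%N); rewrite ?size_poly1 ?size_poly0.
Qed.

Lemma int_poly_upto_sum (C : numClosedFieldType) n m (u : 'I_m -> {poly C}) :
  (forall i, int_poly_upto n (u i)) -> int_poly_upto n (\sum_i u i).
Proof.
move=> Hu; apply: (big_ind (int_poly_upto n)).
- by exists 0; [rewrite rmorph0 | rewrite size_poly0].
- move=> _ _ [c -> sc] [d -> sd]; exists (c + d); first by rewrite rmorphD.
  by rewrite (leq_trans (size_polyD _ _)) // geq_max sc.
- by move=> i _; apply: Hu.
Qed.

Lemma int_egf_mul (C : numClosedFieldType) (f g : fps {poly C}) :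
  int_egf f -> int_egf g -> int_egf (fps_mul f g).
Proof.
move=> Hf Hg n; rewrite /fps_mul scaler_sumr; apply: int_poly_upto_sum => i.
have le_in : (i <= n)%N by rewrite -ltnS.
have [c Ec sc] := Hf i; have [d Ed sd] := Hg (n - i)%N.
exists ('C(n, i)%:R * (c * d)).
  rewrite !rmorphM rmorph_nat /= -Ec -Ed mulr_natl.
  rewrite -[RHS]scaler_nat -scalerAl -scalerAr !scalerA -!natrM.
  by rewrite -mulnA bin_fact.
rewrite mulr_natl -[_ *+ _]scaler_nat (leq_trans (size_scale_leq _ _)) //.
rewrite (leq_trans (size_polyMleq _ _)) //.
have := leq_add sc sd; rewrite addnS addSn subnKC //; case: (_ + _)%N => //.
Qed.

Lemma size_prod_Xsub (m : nat) :
  size (\prod_(i < m) ('X - 1 - i%:R) : {poly int}) = m.+1.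
Proof.
rewrite (eq_bigr (fun i : 'I_m => 'X - (1 + (i : nat)%:R)%:P)).
  by rewrite size_prod_XsubC /index_enum -enumT size_enum_ord.
by move=> i _; rewrite rmorphD rmorph1 rmorph_nat opprD addrA.
Qed.

Lemma int_egf_pow (C : numClosedFieldType) j :
  int_egf (fps_pow_1subqX j.+1 ('X - 1 : {poly C})).
Proof.
move=> n; rewrite /fps_pow_1subqX; case: ifP => [/dvdnP[m ->]|_]; last first.
  by exists 0; [rewrite scaler0 rmorph0 | rewrite size_poly0].
rewrite mulnK // /gbinom.
have le_m : (m <= m * j.+1)%N by rewrite leq_pmulr.
have [d Ed] : exists d, ((m * j.+1)`! = d * m`!)%N.
  exists ('C(m * j.+1, m) * (m * j.+1 - m)`!)%N.
  by rewrite -(bin_fact le_m) -mulnA (mulnC m`!).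
exists ((d%:R * (-1) ^+ m) *: \prod_(i < m) ('X - 1 - i%:R)).
  rewrite map_polyZ rmorphM rmorph_nat rmorphXn rmorphN1 rmorph_prod !scalerA.
  congr (_ *: _).
    by rewrite Ed natrM -!mulrA [_ * (_ * _^-1)]mulrCA divff ?natf_fact_neq0 ?mulr1.
  by apply: eq_bigr => i _; rewrite !rmorphB /= map_polyX rmorph1 rmorph_nat.
by rewrite (leq_trans (size_scale_leq _ _)) // size_prod_Xsub.
Qed.

Lemma int_egf_prod (C : numClosedFieldType) N :
  int_egf (fps_prod (fun j => fps_pow_1subqX j ('X - 1 : {poly C})) N).
Proof.
elim: N => [|N IH] /=; first exact: int_egf_one.
by apply: int_egf_mul; [exact: IH | exact: int_egf_pow].
Qed.

Lemma fps_prod_pow_stable (C : numClosedFieldType) (a : {poly C}) n N :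
  (n <= N)%N -> fps_prod (fun j => fps_pow_1subqX j a) N n =
                fps_prod (fun j => fps_pow_1subqX j a) n n.
Proof.
move=> /subnK <-; elim: (N - n)%N => [|d IH] //.
rewrite addSn /= {1}/fps_mul big_ord_recr /= subnn big1 => [|i _].
  by rewrite /fps_pow_1subqX dvdn0 div0n /gbinom big_ord0 fact0 invr1 !scale1r
             add0r mulr1 IH.
rewrite /fps_pow_1subqX gtnNdvd ?mulr0 ?subn_gt0 //.
by rewrite ltnS (leq_trans (leq_subr _ _)) ?leq_addl.
Qed.

Lemma eta_power_identity_exists (C : numClosedFieldType) :
  exists2 p : nat -> {poly C}, eta_power_identity p &
    forall n, exists c : nat -> int, p n = \poly_(t < n.+1) (c t)%:~R.
Proof.
pose F j := fps_pow_1subqX j ('X - 1 : {poly C}).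
exists (fun n => n`!%:R *: fps_prod F n n) => n.
  exists n => N /fps_prod_pow_stable ->.
  by rewrite scalerA mulVf ?natf_fact_neq0 ?scale1r.
have [c -> sc] := int_egf_prod C n n; exists (fun t => c`_t).
apply/polyP => t; rewrite coef_map coef_poly; case: ltnP => // le_nt.
by rewrite nth_default ?rmorph0 // (leq_trans sc).
Qed.

(* Main.v *)
(* Write f for the product of the (1 - q^j). The logarithmic derivative of
   f^(b-1) gives, with y = 1 - b,
     p_(n+1) = y \sum_(i <= n) sigma(i+1) n(n-1)...(n-i+1) p_(n-i).
   If n = 5k + r with r < 5, the falling factorial vanishes mod 5 for i > r and
   otherwise agrees with that of r. Hence p_(5k+r) = p_(5k) p_r mod 5 for r <= 5.
   Computing p_4 and p_5 from sigma(1), ..., sigma(5) = 1, 3, 4, 7, 6 gives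
     p_(5k+4) = (b - b^5)^k (2b + 4b^2 + 3b^3 + b^4)  mod 5,
   i.e. b^(k+1) times \sum_s d_s b^(4s) (2 + 4b + 3b^2 + b^3), where d_s is the
   s-th coefficient of (1 - b)^k: every block of four is a multiple of
   (2, 4, 3, 1). *)
Require Import Defs.
From mathcomp Require Import all_boot all_order all_algebra.
From mathcomp Require Import ring.

Set Implicit Arguments.
Unset Strict Implicit.
Unset Printing Implicit Defensive.

Import Order.TTheory GRing.Theory Num.Theory.

Local Open Scope ring_scope.

(** * Convolution of power series and logarithmic derivatives *)

Section FpsMul.

Variable R : comNzRingType.
Implicit Types f g h l : fps R.

Lemma fps_mulC f g n : fps_mul f g n = fps_mul g f n.
Proof.
rewrite /fps_mul (reindex_inj rev_ord_inj); apply: eq_bigr => i _ /=.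
have le_in : (i <= n)%N by rewrite -ltnS.
by rewrite mulrC subSS subKn.
Qed.

(** Low coefficients of a product only see truncations, so ring laws such as associativity can be
    inherited from [{poly R}]. *)
Lemma fps_mulE f g m n : (m <= n)%N ->
  fps_mul f g m = ((\poly_(i < n.+1) f i) * (\poly_(i < n.+1) g i))`_m.
Proof.
move=> le_mn; rewrite coefM; apply: eq_bigr => i _; rewrite !coef_poly.
have le_im : (i <= m)%N by rewrite -ltnS.
by rewrite !ltnS (leq_trans le_im) // (leq_trans (leq_subr _ _)).
Qed.

Lemma fps_mulA f g h n :
  fps_mul f (fps_mul g h) n = fps_mul (fps_mul f g) h n.
Proof.
set F := \poly_(i < n.+1) f i; set G := \poly_(i < n.+1) g i.
set H := \poly_(i < n.+1) h i; transitivity ((F * (G * H))`_n).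
  rewrite coefM; apply: eq_bigr => i _.
  by rewrite coef_poly ltn_ord -fps_mulE ?leq_subr.
rewrite mulrA coefM; apply: eq_bigr => i _.
by rewrite coef_poly ltnS leq_subr -fps_mulE // -ltnS.
Qed.

(* [q f'(q) = a l(q) f(q)] *)
Definition has_dlog (a : R) f l := forall n, n%:R * f n = a * fps_mul l f n.

Lemma has_dlog_one a : has_dlog a (fps_one R) (fun=> 0).
Proof.
move=> n; rewrite /fps_mul big1 => [|i _]; last by rewrite mul0r.
by rewrite /fps_one; case: n => [|n]; rewrite ?mul0r !mulr0.
Qed.

Lemma has_dlog_mul a f g l m : has_dlog a f l -> has_dlog a g m ->
  has_dlog a (fps_mul f g) (fun n => l n + m n).
Proof.
move=> Hf Hg n.
have -> : fps_mul (fun n => l n + m n) (fps_mul f g) n =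
    fps_mul (fps_mul l f) g n + fps_mul f (fps_mul m g) n.
  rewrite fps_mulA (_ : fps_mul f _ n = fps_mul (fps_mul m f) g n).
    rewrite -!fps_mulA /fps_mul -big_split /=.
    by apply: eq_bigr => i _; rewrite mulrDl.
  rewrite fps_mulA /fps_mul; apply: eq_bigr => i _; congr (_ * _).
  exact: fps_mulC.
have unf u v : fps_mul u v n = \sum_(i < n.+1) u i * v (n - i)%N by [].
rewrite mulrDr !unf !mulr_sumr -big_split; apply: eq_bigr => i _ /=.
have le_in : (i <= n)%N by rewrite -ltnS.
rewrite [a * (fps_mul l f i * _)]mulrA -Hf [a * (f i * _)]mulrCA -Hg.
(* Leibniz rule: the weight [n] of each term splits as [i + (n - i)]. *)
by rewrite -{1}(subnKC le_in) natrD mulrDl mulrA [f i * (_ * _)]mulrCA.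
Qed.

End FpsMul.

(** * Binomial series of the factors and their finite products *)

Section EtaPower.

Variable C : numClosedFieldType.
Implicit Type a : {poly C}.

Lemma gbinomS a m : m.+1%:R * gbinom a m.+1 = (a - m%:R) * gbinom a m.
Proof.
rewrite /gbinom big_ord_recr /= factS natrM invfM mulr_natl -scaler_nat scalerA.
by rewrite mulrA divff ?pnatr_eq0 // mul1r -scalerAr mulrC.
Qed.

(** Comparison of the coefficients of [q^t] in [q h' = - a (q / (1 - q)) h] for [h = (1 - q)^a]. *)
Lemma sum_gbinom a t :
  t%:R * ((-1) ^+ t *: gbinom a t) =
  - a * \sum_(u < t) (-1) ^+ u *: gbinom a u.
Proof.
elim: t => [|t IH]; first by rewrite big_ord0 mul0r mulr0.
rewrite big_ord_recr /= mulrDr -IH -![_ * ((-1) ^+ _ *: _)]scalerAr gbinomS.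
rewrite exprS mulN1r.
by rewrite -scalerDr -mulrDl scaleNr -scalerN -mulNr opprB.
Qed.

(* [- q h'/h] for [h = 1 - q^j] is [\sum_(i >= 1) j q^(i j)]. *)
Definition dlog_factor (j m : nat) : nat :=
  if (0 < m)%N && (j %| m)%N then j else 0%N.

Lemma has_dlog_pow a j :
  has_dlog (- a) (fps_pow_1subqX j.+1 a) (fun m => (dlog_factor j.+1 m)%:R).
Proof.
(* The last term of the convolution drops out because [dlog_factor] is 0 at 0. *)
move=> n; rewrite fps_mulC /fps_mul /= big_ord_recr /= subnn mulr0 addr0.
have [/dvdnP[t ->]|jNn] := boolP (j.+1 %| n)%N; last first.
  rewrite /fps_pow_1subqX (negPf jNn) mulr0 big1 ?mulr0 // => i _.
  rewrite /dlog_factor; case: ifP => [j_i|_]; last by rewrite mul0r.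
  by rewrite dvdn_subl ?(negPf jNn) ?andbF ?mulr0 // ltnW.
rewrite {1}/fps_pow_1subqX dvdn_mull // mulnK // mulnC natrM -mulrA sum_gbinom.
rewrite [LHS]mulrCA; congr (- a * _); rewrite mulnC.
rewrite [RHS](eq_bigr (fun i : 'I__ =>
  j.+1%:R * fps_pow_1subqX j.+1 a i)) => [|i _].
  rewrite -[RHS]mulr_sumr; congr (_ * _).
  (* In each block of [j.+1] indices only the first is a multiple of [j.+1], so a block adds a
     single signed binomial coefficient. *)
  elim: t => [|t IH]; first by rewrite !big_ord0.
  rewrite big_ord_recr /= {}IH mulSnr big_split_ord /=; congr (_ + _).
  rewrite big_ord_recl big1 => [|i _] /=.
    by rewrite addr0 addn0 /fps_pow_1subqX dvdn_mull // mulnK.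
  rewrite /fps_pow_1subqX dvdn_addr ?dvdn_mull // gtnNdvd //.
  by rewrite /bump ltnS ltn_ord.
rewrite mulrC /fps_pow_1subqX; case: ifP => [j_i|_]; last by rewrite !mulr0.
by rewrite /dlog_factor subn_gt0 ltn_ord dvdn_subl ?dvdn_mull // ltnW.
Qed.

(* For [0 < m <= N] this is the sum of the divisors of [m]. *)
Definition dlog_prod (N m : nat) : nat :=
  (\sum_(j < N) dlog_factor j.+1 m)%N.

Lemma has_dlog_prod a N :
  has_dlog (- a) (fps_prod (fun j => fps_pow_1subqX j a) N)
    (fun m => (dlog_prod N m)%:R).
Proof.
elim: N => [|N IH] n /=.
  rewrite (has_dlog_one (- a)); congr (_ * _); apply: eq_bigr => i _.
  by rewrite /dlog_prod big_ord0.
rewrite (has_dlog_mul IH (has_dlog_pow a N)); congr (_ * _).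
by apply: eq_bigr => i _; rewrite /dlog_prod big_ord_recr natrD.
Qed.
End EtaPower.

(** * Integral recurrence for the coefficients *)

Section Recurrence.

Variables (C : numClosedFieldType) (N : nat).

Let G := fps_prod (fun j => fps_pow_1subqX j ('X - 1 : {poly C})) N.

Lemma fps_prod_int :
  {P : nat -> {poly int} | forall n, n`!%:R *: G n = map_poly intr (P n)}.
Proof.
have ex_P n : exists c, n`!%:R *: G n == map_poly intr c.
  by have [c /eqP Ec _] := int_egf_prod C N n; exists c.
by exists (fun n => xchoose (ex_P n)) => n; apply/eqP/(xchooseP (ex_P n)).
Qed.

Lemma fps_prod_int_rec (P : nat -> {poly int}) :
  (forall n, n`!%:R *: G n = map_poly intr (P n)) ->
  forall n, P n.+1 =
    (1 - 'X) * \sum_(i < n.+1) (dlog_prod N i.+1 * n ^_ i)%:R * P (n - i)%N.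
Proof.
move=> HP n; apply: (map_inj_poly (@intr_inj C) (rmorph0 _)).
have scale_nat m (v : {poly C}) : m%:R *: v = m%:R * v.
  by rewrite scaler_nat mulr_natl.
rewrite rmorphM rmorphB rmorph1 /= map_polyX rmorph_sum -HP.
rewrite scale_nat factS mulnC natrM -mulrA.
rewrite (has_dlog_prod ('X - 1) N) opprB mulrCA; congr (_ * _).
rewrite /fps_mul big_ord_recl {1}/dlog_prod big1 // mul0r add0r.
rewrite mulr_sumr; apply: eq_bigr => i _.
rewrite rmorphM rmorph_nat /= -HP scale_nat /bump add1n subSS.
(* In [n! = n ^_ i * (n - i)!] the second factor clears the denominators of the coefficient of index
   [n - i]; the first remains as its weight. *)
rewrite -(ffact_fact (ltn_ord i : i <= n)%N) !natrM.
by rewrite mulrACA [_%:R * (dlog_prod _ _)%:R]mulrC.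
Qed.

End Recurrence.

(** A divisor of [m] is at most [m], so later factors add nothing. This makes the first divisor sums
    computable for an unspecified [N]. *)
Lemma dlog_prod_small N m : (m <= N)%N -> dlog_prod N m = dlog_prod m m.
Proof.
move=> /subnKC <-; rewrite {1}/dlog_prod big_split_ord /=.
rewrite [X in (_ + X)%N]big1 ?addn0 // => i _.
rewrite /dlog_factor; case: ifP => // /andP[m_gt0 /(dvdn_leq m_gt0)].
by rewrite ltnNge leq_addr.
Qed.

(** * Solving the recurrence modulo 5 *)

Section ModFive.

Variables (R : comNzRingType) (x : R).
Hypothesis R5 : 5%:R = 0 :> R.

(** Up to index [r] corresponding factors differ by [5 * k]; those of index [r] are [5 * k] and 0,
    so beyond it both products vanish. *)
Lemma natr_ffact_mod5 k r i : ((5 * k + r) ^_ i)%:R = (r ^_ i)%:R :> R.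
Proof.
elim: i => [|i IH]; first by rewrite !ffactn0.
rewrite !ffactnSr !natrM IH; have [le_ir|lt_ri] := leqP i r.
  by rewrite -addnBA // natrD natrM R5 mul0r add0r.
by rewrite ffact_small // !mul0r.
Qed.

Variables (N : nat) (Q : nat -> R).
Hypothesis N_ge5 : (5 <= N)%N.
Hypothesis Q0 : Q 0 = 1.
Hypothesis Q_rec : forall n, Q n.+1 =
  (1 - x) * \sum_(i < n.+1) (dlog_prod N i.+1 * n ^_ i)%:R * Q (n - i)%N.

(* The terms with [r < i] have [n ^_ i = 0] mod 5, so [Q] never looks past the
   previous multiple of 5. *)
Lemma falling_rec_mod5 k r : Q (5 * k + r).+1 =
  (1 - x) * \sum_(i < r.+1)
    (dlog_prod N i.+1 * r ^_ i)%:R * Q (5 * k + r - i)%N.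
Proof.
rewrite Q_rec; congr (_ * _); rewrite -addnS addnC big_split_ord /=.
rewrite [X in _ + X]big1 ?addr0 => [|i _]; last first.
  by rewrite natrM natr_ffact_mod5 ffact_small ?mulr0 ?mul0r // ltnS leq_addr.
by apply: eq_bigr => i _; rewrite !natrM natr_ffact_mod5.
Qed.

Lemma falling_rec_step5 k :
  Q (5 * k + 4) = (2 * x + 4 * x ^+ 2 + 3 * x ^+ 3 + x ^+ 4) * Q (5 * k) /\
  Q (5 * k.+1) = (x - x ^+ 5) * Q (5 * k).
Proof.
have s_small m : (m <= 5)%N -> dlog_prod N m = dlog_prod m m.
  by move=> /leq_trans/(_ N_ge5); apply: dlog_prod_small.
have [s1 s2 s3 s4 s5] : [/\ dlog_prod N 1 = 1, dlog_prod N 2 = 3,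
    dlog_prod N 3 = 4, dlog_prod N 4 = 7 & dlog_prod N 5 = 6]%N.
  by rewrite !s_small // /dlog_prod !big_ord_recr !big_ord0.
(* Each instance expresses the next value of [Q] by earlier ones; substituting from the last to the
   first leaves only [Q (5 * k)]. *)
have := (falling_rec_mod5 k 0, falling_rec_mod5 k 1, falling_rec_mod5 k 2, falling_rec_mod5 k 3,
         falling_rec_mod5 k 4).
rewrite !big_ord_recl !big_ord0 /= /bump /= s1 s2 s3 s4 s5 !addr0.
rewrite !subn0 -!addnBA // -!addnS !addn0 /=.
move=> [[[[E1 E2] E3] E4] E5]; rewrite (mulnS 5 k) (addnC 5%N) E5 E4 E3 E2 E1.
set q := Q _; set y := 1 - x.
(* The integer identities hold up to a multiple of 5, added here explicitly. *)
split.
- rewrite -[RHS]addr0 -[X in _ = _ + X](mul0r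
    ((2 - 5 * x + 3 * x ^+ 2 - 2 * x ^+ 3 + 3 * y ^+ 3 + 11 * y ^+ 2 + 8 * y)
     * q)) -R5 /y /falling_factorial /= ?muln1 ?mul1n.
  ring.
- rewrite -[RHS]addr0 -[X in _ = _ + X](mul0r
    ((2 * x ^+ 2 - x - 2 * x ^+ 3 + x ^+ 4 + 6 * y ^+ 4 + 43 * y ^+ 3
      + 90 * y ^+ 2 + 29 * y) * q)) -R5 /y /falling_factorial /= ?muln1 ?mul1n.
  ring.
Qed.

Lemma falling_rec_closed_form k : Q (5 * k + 4) =
  (x - x ^+ 5) ^+ k * (2 * x + 4 * x ^+ 2 + 3 * x ^+ 3 + x ^+ 4).
Proof.
have [-> _] := falling_rec_step5 k; rewrite [LHS]mulrC; congr (_ * _).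
elim: k => [|k IH]; first by rewrite muln0 Q0.
by have [_ ->] := falling_rec_step5 k; rewrite IH [RHS]exprS.
Qed.

End ModFive.

(** * Splitting coefficients and counts into blocks *)

Lemma coef_comp_poly_Xn_mul (R : nzRingType) (D A : {poly R}) m s i :
  (size A <= m)%N -> (i < m)%N ->
  ((D \Po 'X^m) * A)`_(s * m + i) = D`_s * A`_i.
Proof.
move=> sA lt_im; have m_gt0 : (0 < m)%N by case: m lt_im {sA}.
have lt_s : (s * m < (s * m + i).+1)%N by rewrite ltnS leq_addr.
rewrite coefM (bigD1 (Ordinal lt_s)) //= big1 => [|j ne_j].
  by rewrite coef_comp_poly_Xn // dvdn_mull // mulnK // addKn addr0.
rewrite coef_comp_poly_Xn //; case: ifP => [/dvdnP[u Eu]|_]; last by rewrite mul0r.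
have le_um : (u * m <= s * m + i)%N by rewrite -Eu -ltnS.
have lt_us : (u < s)%N.
  rewrite ltn_neqAle; apply/andP; split.
    by apply: contraNneq ne_j => Eus; apply/eqP/val_inj; rewrite /= Eu Eus.
  rewrite -ltnS -(ltn_pmul2r m_gt0) mulSnr.
  by apply: leq_ltn_trans le_um _; rewrite ltn_add2l.
(* An earlier block [u < s] would need a coefficient of [A] at an index at least [m], beyond its
   size. *)
rewrite [A`__]nth_default ?mulr0 // (leq_trans sA) // Eu.
apply: leq_trans (leq_sub2r _ (leq_addr i _)).
by rewrite -mulnBl leq_pmull // subn_gt0.
Qed.

Lemma intr_Fp_eqmod (p : nat) (m n : int) : prime p ->
  m%:~R = n%:~R :> 'F_p -> (m = n %[mod p])%Z.
Proof.
move=> p_pr Emn; apply/eqP; rewrite eqz_mod_dvd.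
by rewrite (dvdz_pcharf (pchar_Fp p_pr)) rmorphB /= Emn subrr.
Qed.

(** With [m = k.+1] the range is exactly the [5 * k + 5] coefficient indices. *)
Lemma sum_count_blocks (P : pred nat) k m :
  (forall t, (t <= k)%N -> ~~ P t) ->
  (\sum_(t < k.+1 + m * 4) P t)%N =
  (\sum_(s < m) count P [seq (k + 4 * s + i)%N | i <- [:: 1; 2; 3; 4]])%N.
Proof.
move=> P_low; elim: m => [|m IH].
  rewrite addn0 big_ord0 big1 // => i _.
  by rewrite (negPf (P_low i _)) // -ltnS.
rewrite mulSnr addnA big_split_ord /= IH [RHS]big_ord_recr /=; congr (_ + _)%N.
rewrite (eq_bigr (fun i : 'I_4 => P (k + 4 * m + i.+1)%N : nat)) => [|i _].
  by rewrite !big_ord_recl big_ord0.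
by rewrite (mulnC m) addnS !addSn.
Qed.

(** The multiples of (2, 4, 3, 1) by 0, 1, 2, 4, 3. Since 2, 4, 3, 1 are the successive powers of 2
    mod 5, scaling by a unit is a rotation. *)
Definition residue_blocks : seq (seq int) :=
  [:: [:: 0; 0; 0; 0]; [:: 2; 4; 3; 1]; [:: 4; 3; 1; 2];
      [:: 3; 1; 2; 4]; [:: 1; 2; 4; 3]].

(** A nonzero block contains each of 1, 2, 3, 4 once, and the zero block none of them. *)
Lemma count_residue_blocks (r r' : nat) (b : seq int) : b \in residue_blocks ->
  (0 < r < 5)%N -> (0 < r' < 5)%N ->
  count_mem (r : int) b = count_mem (r' : int) b.
Proof.
by rewrite !inE => /or4P[||| /orP[]] /eqP->;
   case: r r' => [|[|[|[|[|r]]]]] [|[|[|[|[|r']]]]].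
Qed.

(** * Residues of the coefficients of [p n] *)

Lemma eta_poly_mod5 (C : numClosedFieldType) (p : nat -> {poly C})
    (hp : eta_power_identity p) (k n : nat) (hn : n = (5 * k + 4)%N)
    (c : nat -> int) (hc : p n = \poly_(t < n.+1) (c t)%:~R) (t : nat) :
  (t <= n)%N -> (c t)%:~R =
  ('X^(k.+1) * (((1 - 'X) ^+ k \Po 'X^4) * Poly [:: 2; 4; 3; 1])
     : {poly 'F_5})`_t.
Proof.
move=> le_tn; set A := Poly _; have [N0 /(_ (maxn N0 5) (leq_maxl _ _))] := hp n.
(* [N0] makes the coefficient of [q^n] final, and 5 makes the divisor sums up to 5 complete. *)
set N := maxn N0 5 => pE; have [P HP] := fps_prod_int C N.
have -> : c t = (P n)`_t.
  apply: (@intr_inj C); rewrite -coef_map /= -HP pE scalerA.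
  by rewrite divff ?natf_fact_neq0 // scale1r hc coef_poly ltnS le_tn.
rewrite -coef_map /=; congr (nth _ (polyseq _) _).
pose Q m : {poly 'F_5} := map_poly intr (P m).
have P0 : P 0 = 1.
  apply: (map_inj_poly (@intr_inj C) (rmorph0 _)).
  by rewrite -HP fps_prod_pow_stable // scale1r rmorph1.
have Q0 : Q 0 = 1 by rewrite /Q P0 rmorph1.
have Q_rec m : Q m.+1 = (1 - 'X) *
    \sum_(i < m.+1) (dlog_prod N i.+1 * m ^_ i)%:R * Q (m - i)%N.
  rewrite /Q (fps_prod_int_rec HP) rmorphM rmorphB rmorph1 /= map_polyX.
  rewrite rmorph_sum; congr (_ * _); apply: eq_bigr => i _.
  by rewrite rmorphM rmorph_nat.
have F5 : 5%:R = 0 :> {poly 'F_5}.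
  by rewrite -polyC_natr (pchar_Fp_0 (isT : prime 5)) polyC0.
rewrite -/(Q n) hn (falling_rec_closed_form F5 (leq_maxr _ _) Q0 Q_rec).
(* The [k]-th power supplies ['X^k], and the quartic factor one more ['X]. *)
have -> : 'X - 'X^5 = 'X * (1 - 'X^4) :> {poly 'F_5} by ring.
have -> : A = 2 + 4 * 'X + 3 * 'X^2 + 'X^3.
  rewrite /A /= !cons_poly_def polyC0 polyC1 !polyC_natr.
  by ring.
rewrite (rmorphXn (comp_poly 'X^4)) rmorphB rmorph1 /= comp_polyX.
rewrite exprMn (exprS 'X k); ring.
Qed.

Theorem theorem1p1 (C : numClosedFieldType) (p : nat -> {poly C})
    (hp : eta_power_identity p) (k n : nat) (hn : n = (5 * k + 4)%N)
    (c : nat -> int) (hc : p n = \poly_(t < n.+1) (c t)%:~R) :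
  [/\ forall r r' : nat, (0 < r < 5)%N -> (0 < r' < 5)%N ->
        #|[set t : 'I_n.+1 | (c t == r %[mod 5])%Z]| =
        #|[set t : 'I_n.+1 | (c t == r' %[mod 5])%Z]|,
      forall s : nat, (s <= k)%N ->
        [seq (c (k + 4 * s + i)%N %% 5)%Z | i <- [:: 1; 2; 3; 4]%N] \in
          [:: [:: 0; 0; 0; 0]; [:: 2; 4; 3; 1]; [:: 4; 3; 1; 2];
              [:: 3; 1; 2; 4]; [:: 1; 2; 4; 3]]
    & forall t : nat, (t <= k)%N -> (c t = 0 %[mod 5])%Z].
Proof.
have c_mod5 := eta_poly_mod5 hp hn hc.
have c_low t : (t <= k)%N -> (c t = 0 %[mod 5])%Z.
  move=> le_tk; apply: (@intr_Fp_eqmod 5) => //.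
  rewrite c_mod5 ?coefXnM ?ltnS ?le_tk // hn.
  by rewrite (leq_trans le_tk) // -addnA (leq_trans _ (leq_addr _ _)) ?leq_pmull.
have c_block s : (s <= k)%N ->
    [seq (c (k + 4 * s + i)%N %% 5)%Z | i <- [:: 1; 2; 3; 4]%N]
      \in residue_blocks.
  move=> le_sk; pose d : 'F_5 := ((1 - 'X) ^+ k)`_s.
  have cE i : (i < 4)%N -> (c (k + 4 * s + i.+1)%N %% 5)%Z =
      ((d * nth 0 [:: 2; 4; 3; 1] i) %% 5)%N.
    move=> lt_i4; rewrite -modz_nat; apply: (@intr_Fp_eqmod 5) => //.
    rewrite c_mod5; last first.
      rewrite hn -addnA (mulSnr 4 k : 5 * k = _)%N [(4 * k + k)%N]addnC -addnA.
      by rewrite leq_add2l leq_add // leq_mul2l.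
    rewrite coefXnM addnS -addnA; case: ifP => [|_].
      by rewrite ltnS ltnNge leq_addr.
    rewrite subSS addKn mulnC coef_comp_poly_Xn_mul ?size_Poly //.
    rewrite -/d coef_Poly -pmulrn natrM natr_Zp; congr (_ * _).
    by case: i lt_i4 => [|[|[|[|i]]]].
  (* The five values of [d] in ['F_5] give the five admissible blocks. *)
  rewrite /= !cE //=; case: d {cE} => [[|[|[|[|[|d]]]]] Hd] //=.
split=> // r r' Hr Hr'.
have card_eq r0 : (0 < r0 < 5)%N ->
    #|[set t : 'I_n.+1 | (c t == r0 %[mod 5])%Z]| =
    (\sum_(s < k.+1) count_mem (r0 : int)
       [seq (c (k + 4 * s + i)%N %% 5)%Z | i <- [:: 1; 2; 3; 4]%N])%N.
  case/andP=> r0_gt0 r0_lt5.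
  have r0E : ((r0 : int) %% 5)%Z = r0 by rewrite modz_nat modn_small.
  (* The [k.+1] vanishing low coefficients are followed by [k.+1] blocks of four. *)
  have nE : n.+1 = (k.+1 + k.+1 * 4)%N.
    by rewrite hn -(mulnS k.+1 4) (mulSnr k 5) (mulnC k) !addnS.
  transitivity (\sum_(t < n.+1) ((c t %% 5)%Z == r0))%N.
    rewrite -sum1dep_card big_mkcond; apply: eq_bigr => i _.
    by rewrite r0E; case: (_ == _).
  rewrite nE (sum_count_blocks (P := fun t => (c t %% 5)%Z == r0)).
    by apply: eq_bigr.
  by move=> t /c_low ->; rewrite mod0z; case: r0 r0_gt0 {r0_lt5 r0E}.
rewrite !card_eq //; apply: eq_bigr => s _.
by apply: count_residue_blocks => //; apply: c_block; rewrite -ltnS.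
Qed.
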